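(* Any Fra\''iss\'e Banach space is almost Fra\''iss\'e, and any weak Fra\''iss\'e Banach space is weak almost Fra\''iss\'e.
   Context: For Banach spaces $X,E$ and $\delta\ge 0$, a $\delta$-isometry from $X$ to $E$ is a linear map $T\colon X\to E$ with $\frac{1}{1+\delta}\|x\|\le\|Tx\|\le(1+\delta)\|x\|$ for all $x\in X$. $\mathrm{Emb}_\delta(X,E)$ is the set of $\delta$-isometries from $X$ into $E$; $\mathrm{Isom}(E)$ (resp. $\mathrm{Isom}_\varepsilon(E)$) is the set of surjective linear isometries (resp. surjective $\varepsilon$-isometries) from $E$ onto $E$. $\mathrm{Age}(E)$ (resp. $\mathrm{Age}_k(E)$) is the set of finite-dimensional (resp. $k$-dimensional) subspaces of $E$. $E$ is Fra\''iss\'e if for every $\varepsilon>0$ and $k\in\mathbb N$ there is $\delta>0$ such that if $X\in\mathrm{Age}_k(E)$ and $\phi,\psi\in\mathrm{Emb}_\delta(X,E)$, there is $T\in\mathrm{Isom}(E)$ with $\|T\circ\phi-\psi\|<\varepsilon$. $E$ is weak Fra\''iss\'e if for every $\varepsilon>0$ and $X\in\mathrm{Age}(E)$ there is $\delta>0$ such that if $\phi,\psi\in\mathrm{Emb}_\delta(X,E)$, there is $T\in\mathrm{Isom}(E)$ with $\|T\circ\phi-\psi\|<\varepsilon$. $E$ is almost Fra\''iss\'e if for every $k\in\mathbb N$ and $\varepsilon>0$ there is $\delta>0$ such that for every $X\in\mathrm{Age}_k(E)$ and every $\phi\in\mathrm{Emb}_\delta(X,E)$ there is $T\in\mathrm{Isom}_\varepsilon(E)$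 with $T|_X=\phi$. $E$ is weak almost Fra\''iss\'e if for every $X\in\mathrm{Age}(E)$ and $\varepsilon>0$ there is $\delta>0$ such that for every $\phi\in\mathrm{Emb}_\delta(X,E)$ there is $T\in\mathrm{Isom}_\varepsilon(E)$ with $T|_X=\phi$. *)

(* Defs.v *)
From HB Require Import structures.
From mathcomp Require Import all_boot all_order all_algebra.
From mathcomp Require Import all_classical all_reals all_analysis.
From mathcomp Require Export complex.
Import Order.TTheory GRing.Theory Num.Theory numFieldNormedType.Exports.

Set Implicit Arguments.
Unset Strict Implicit.
Unset Printing Implicit Defensive.

Local Open Scope classical_set_scope.
Local Open Scope ring_scope.

(* Everything is parametrized by the scalar field K, to be instantiated with R
   and R[i] for R : realType.  Norms take their values in K, and 0 < e in K
   forces e to be real. *)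

(* A linear subspace is given by its membership predicate X : submodClosed E;
   [subsp X] is the normed space that it carries. *)
Definition subsp (K : numFieldType) (E : normedModType K)
  (X : submodClosed E) : Type := {x : E | x \in X}.

Section SubspaceNormed.
Context (K : numFieldType) (E : normedModType K) (X : submodClosed E).

HB.instance Definition _ := SubChoice.on (subsp X).
HB.instance Definition _ := [SubChoice_isSubLmodule of subsp X by <:].

Let norm_subsp (x : subsp X) : K := `|val x|.

Let ler_norm_subspD x y : norm_subsp (x + y) <= norm_subsp x + norm_subsp y.
Proof. by rewrite /norm_subsp raddfD; exact: ler_normD. Qed.

Let norm_subspZ l x : norm_subsp (l *: x) = `|l| * norm_subsp x.
Proof. by rewrite /norm_subsp linearZ /= normrZ. Qed.

Let norm_subsp0_eq0 x : norm_subsp x = 0 -> x = 0.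
Proof. by move=> /normr0_eq0 x0; apply: val_inj; rewrite x0 raddf0. Qed.

HB.instance Definition _ := @Lmodule_isNormed.Build K (subsp X)
  norm_subsp ler_norm_subspD norm_subspZ norm_subsp0_eq0.

End SubspaceNormed.

Section Fraisse.
Context (K : numFieldType).

Definition is_basis (V : lmodType K) (k : nat) (b : 'I_k -> V) : Prop :=
  (forall c : 'I_k -> K, \sum_(i < k) c i *: b i = 0 -> forall i, c i = 0) /\
  (forall v : V, exists c : 'I_k -> K, v = \sum_(i < k) c i *: b i).

Definition Age_ (k : nat) (E : normedModType K) (X : submodClosed E) : Prop :=
  exists b : 'I_k -> subsp X, is_basis b.

Definition Age (E : normedModType K) (X : submodClosed E) : Prop :=
  exists k : nat, Age_ k X.

(* [supremum] returns its default value 0 on an unbounded operator; the operator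
   norm is only taken of differences of bounded operators below. *)
Definition opnorm (X E : normedModType K) (A : {linear X -> E}) : K :=
  supremum 0 [set `|A x| | x in [set x : X | `|x| <= 1]].

Definition Emb (d : K) (X E : normedModType K) : set {linear X -> E} :=
  [set T | forall x : X,
     (1 + d)^-1 * `|x| <= `|T x| /\ `|T x| <= (1 + d) * `|x|].

Definition Isom (E : normedModType K) : set {linear E -> E} :=
  [set T | (forall x : E, `|T x| = `|x|) /\ set_surj setT setT T].

Definition Isom_ (e : K) (E : normedModType K) : set {linear E -> E} :=
  [set T | Emb e T /\ set_surj setT setT T].

Definition fraisse (E : completeNormedModType K) : Prop :=
  forall (e : K) (k : nat), 0 < e -> exists2 d : K, 0 < d &
    forall X : submodClosed E, Age_ k X ->
    forall phi psi : {linear subsp X -> E}, Emb d phi -> Emb d psi ->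
    exists2 T : {linear E -> E}, Isom T & opnorm ((T \o phi) \- psi) < e.

Definition weak_fraisse (E : completeNormedModType K) : Prop :=
  forall (e : K) (X : submodClosed E), 0 < e -> Age X ->
  exists2 d : K, 0 < d &
    forall phi psi : {linear subsp X -> E}, Emb d phi -> Emb d psi ->
    exists2 T : {linear E -> E}, Isom T & opnorm ((T \o phi) \- psi) < e.

Definition almost_fraisse (E : completeNormedModType K) : Prop :=
  forall (k : nat) (e : K), 0 < e -> exists2 d : K, 0 < d &
    forall X : submodClosed E, Age_ k X ->
    forall phi : {linear subsp X -> E}, Emb d phi ->
    exists2 T : {linear E -> E}, Isom_ e T &
      forall x : subsp X, T (val x) = phi x.

Definition weak_almost_fraisse (E : completeNormedModType K) : Prop :=
  forall (X : submodClosed E) (e : K), Age X -> 0 < e ->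
  exists2 d : K, 0 < d &
    forall phi : {linear subsp X -> E}, Emb d phi ->
    exists2 T : {linear E -> E}, Isom_ e T &
      forall x : subsp X, T (val x) = phi x.

End Fraisse.

(* Main.v *)
(* Let [X] be k-dimensional and [phi : X -> E] a d-isometry.  Applying the Fraisse
   property to the inclusion of [X] and to [phi] gives a surjective isometry [T]
   of [E] with [phi - T] small on [X].  The map [T + (phi - T) o P], where [P] is
   a projection of [E] onto [X], extends [phi]; since [P] can be chosen with norm
   at most a constant C_k depending only on k, it is an e-isometry once
   [|phi - T| C_k <= e / (1 + e)].  Being an injective finite-rank perturbation of
   a surjection, it is also surjective.  The projections come from the Hahn-Banach
   theorem by induction on k, without compactness. *)
From HB Require Import structures.
Require Import Defs.
From mathcomp Require Import all_boot all_order all_algebra.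
From mathcomp Require Import all_classical all_reals all_analysis.
From mathcomp Require Import complex.
From mathcomp Require Import ring lra.
Import Order.TTheory GRing.Theory Num.Theory numFieldNormedType.Exports.
Local Open Scope ring_scope.
Local Open Scope complex_scope.

Set Implicit Arguments.
Unset Strict Implicit.
Unset Printing Implicit Defensive.

(** * The Hahn-Banach theorem for a real seminorm *)

Section HahnBanach.
Local Open Scope classical_set_scope.
Context {R : realType} {V : lmodType R} (p : V -> R).
Hypothesis p_triangle : forall x y, p (x + y) <= p x + p y.
Hypothesis p_homogeneous : forall a x, p (a *: x) = `|a| * p x.

(** Partial functionals are encoded as graphs, ordered by inclusion for Zorn's lemma. The last
    clause is conditional because the union of an empty chain is the empty graph. *)
Let dominated (x0 : V) (G : set (V * R^o)) : Prop :=
  [/\ forall a u v, G u -> G v -> G (a *: u + v),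
      forall u, G u -> u.2 <= p u.1 &
      forall u, G u -> G (x0, p x0)].

Let dominated_bigcup x0 (F : set (set (V * R^o))) :
  F `<=` dominated x0 -> total_on F subset ->
  dominated x0 (\bigcup_(G in F) G).
Proof.
move=> Fdom Ftot; split.
- move=> a u v [G FG Gu] [H FH Hv].
  have [GH|HG] := Ftot _ _ FG FH.
  + by exists H => //; have [lin _ _] := Fdom _ FH; apply: lin => //; exact: GH.
  + by exists G => //; have [lin _ _] := Fdom _ FG; apply: lin => //; exact: HG.
- by move=> u [G /Fdom [_ + _]]; exact.
- by move=> u [G FG Gu]; exists G => //; have [_ _ /(_ _ Gu)] := Fdom _ FG.
Qed.

(** One-dimensional extension: an admissible value at [x] lies above every [u.2 - p (u.1 - x)] and
    below every [p (v.1 + x) - v.2]; the supremum of the former is taken. Homogeneity reduces a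
    nonzero [t] to [t = 1] or [t = -1]. *)
Let extension_value x0 G x : dominated x0 G -> G (x0, p x0) ->
  exists r : R, forall (t : R) u, G u -> u.2 + t * r <= p (u.1 + t *: x).
Proof.
move=> [lin dom _] G0.
have GZ a u : G u -> G (a *: u).
  move=> Gu; have /(lin (a - 1)) := Gu => /(_ _ Gu).
  by rewrite scalerBl scale1r subrK.
pose S := [set u.2 - p (u.1 - x) | u in G].
have key u v : G u -> G v -> u.2 - p (u.1 - x) <= p (v.1 + x) - v.2.
  move=> Gu Gv; rewrite lerBrDr addrAC lerBlDr.
  have := lin 1 _ _ Gu Gv; rewrite scale1r => /dom /= /le_trans; apply.
  rewrite (_ : u.1 + v.1 = (v.1 + x) + (u.1 - x)) ?p_triangle //.
  by rewrite addrACA subrr addr0 addrC.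
have supS : has_sup S.
  split; first by exists ((x0, p x0).2 - p ((x0, p x0).1 - x)), (x0, p x0).
  by exists (p ((x0, p x0).1 + x) - (x0, p x0).2) => _ [u Gu <-]; exact: key.
exists (sup S) => t u Gu.
have [t0|t0|->] := ltgtP t 0; last first.
- by rewrite mul0r scale0r !addr0 dom.
- have le_r : sup S <= p (t^-1 *: u.1 + x) - t^-1 * u.2.
    apply: ge_sup; first by have [] := supS.
    by move=> _ [v Gv <-]; apply: (key v (t^-1 *: u) Gv); exact: GZ.
  rewrite (_ : u.1 + t *: x = t *: (t^-1 *: u.1 + x)); last first.
    by rewrite scalerDr scalerA mulfV ?gt_eqF// scale1r.
  rewrite p_homogeneous gtr0_norm//.
  rewrite -(ler_pM2l t0) mulrBr mulrA mulfV ?gt_eqF// mul1r in le_r.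
  by rewrite addrC -lerBrDr.
- have s0 : 0 < - t by rewrite oppr_gt0.
  have ge_r : (- t)^-1 * u.2 - p ((- t)^-1 *: u.1 - x) <= sup S.
    apply: ub_le_sup; first by have [] := supS.
    by exists ((- t)^-1 *: u) => //; exact: GZ.
  rewrite (_ : u.1 + t *: x = (- t) *: ((- t)^-1 *: u.1 - x)); last first.
    by rewrite scalerBr scalerA mulfV ?gt_eqF// scale1r scaleNr opprK.
  rewrite p_homogeneous (gtr0_norm s0).
  rewrite -(ler_pM2l s0) mulrBr mulrA mulfV ?gt_eqF// mul1r in ge_r.
  by move: ge_r; set P := p _; lra.
Qed.

(** A maximal dominated graph is total, since [extension_value] would otherwise enlarge it. *)
Lemma hahn_banach (x0 : V) : exists f : V -> R,
  [/\ forall a x y, f (a *: x + y) = a * f x + f y,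
      forall x, f x <= p x & f x0 = p x0].
Proof.
have p0 : p 0 = 0 by rewrite -(scale0r (0 : V)) p_homogeneous normr0 mul0r.
have pN x : p (- x) = p x by rewrite -scaleN1r p_homogeneous normrN1 mul1r.
have p_ge0 x : 0 <= p x.
  by have := p_triangle x (- x); rewrite subrr p0 pN; lra.
have [G [Gdom Gmax]] := Zorn_bigcup (@dominated_bigcup x0).
pose L := range (fun t : R => (t *: x0, t * p x0) : V * R^o).
have Ldom : dominated x0 L.
  split.
  - move=> a _ _ [s _ <-] [t _ <-]; exists (a * s + t) => //.
    by apply: injective_projections => /=;
      [rewrite scalerDl scalerA|rewrite mulrDl -mulrA].
  - move=> _ [t _ <-] /=; rewrite p_homogeneous.
    by rewrite ler_wpM2r// ler_norm.
  - by move=> _ _; exists 1 => //; rewrite scale1r mul1r.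
have G0 : G (x0, p x0).
  (* Maximality excludes the empty graph, which is strictly contained in [L]. *)
  have [[u Gu]|/set0P/negP/negPn/eqP GE] := pselect (G !=set0).
    by have [_ _ /(_ _ Gu)] := Gdom.
  exfalso; apply: (Gmax L) => //; rewrite GE; split => // /(_ (x0, p x0)); apply.
  by exists 1; rewrite // scale1r mul1r.
have [lin dom _] := Gdom.
have G00 : G 0 by have := lin (-1) _ _ G0 G0; rewrite scaleN1r addNr.
have total x : exists r : R, G (x, r).
  have [r rP] := @extension_value x0 G x Gdom G0; exists r.
  pose H := [set z | exists t u, G u /\ z = u + t *: ((x, r) : V * R^o)].
  have GH : G `<=` H.
    by move=> u Gu; exists 0, u; rewrite scale0r addr0.
  have Hdom : dominated x0 H.
    split.
    - move=> a _ _ [s [u [Gu ->]]] [t [v [Gv ->]]].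
      exists (a * s + t), (a *: u + v); split; first exact: lin.
      by rewrite scalerDr scalerA scalerDl addrACA.
    - by move=> _ [t [u [Gu ->]]]; exact: rP.
    - by move=> _ _; exact: GH.
  have HG : H `<=` G.
    apply: contrapT => HG; by apply: (Gmax H) => //; split.
  apply: HG; exists 1, 0; split; first exact: G00.
  by rewrite scale1r add0r.
have [f fP] := choice total.
(* The difference of two points of [G] above [x] has the form [(0, s)]; domination of [s] and [- s]
   by [p 0 = 0] gives [s = 0]. *)
have uniq x r : G (x, r) -> r = f x.
  move=> Gr.
  have d1 := lin (-1) _ _ (fP x) Gr; have d2 := lin (-1) _ _ Gr (fP x).
  move: (dom _ d1) (dom _ d2) => /=.
  rewrite !scaleN1r !addNr p0; lra.
exists f; split.
- by move=> a x y; apply/esym/uniq; exact: (lin a _ _ (fP x) (fP y)).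
- by move=> x; exact: dom (fP x).
- exact/esym/uniq.
Qed.

End HahnBanach.

(** * Norming functionals over the real and complex scalars *)

(* The factor 2, which is 1 in the sharp form, spares a rotation argument over
   the complex numbers. *)
Definition norming_functionals (K : numFieldType) (E : normedModType K) : Prop :=
  forall x : E, x != 0 -> exists f : E -> K,
    [/\ scalar f, f x = 1 & forall y, `|f y| * `|x| <= 2 * `|y|].

Lemma norming_functionals_real (R : realType) (E : normedModType R) :
  norming_functionals E.
Proof.
move=> x x0.
have [f [flin fle fx]] := @hahn_banach R E Num.norm (@ler_normD _ E)
  (@normrZ _ E) x.
have nx0 : `|x| != 0 by rewrite normr_eq0.
have fN y : f (- y) = - f y.
  have f0 : f 0 = 0 by have := flin 1 0 0; rewrite scale1r add0r mul1r; lra.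
  by have := flin (-1) y 0; rewrite scaleN1r addr0 f0 addr0 mulN1r.
exists (fun y => f y / `|x|); split.
- by move=> a u v; rewrite flin mulrDl mulrA.
- by rewrite fx divff.
- move=> y; rewrite normrM normfV normr_id mulfVK//.
  apply: (@le_trans _ _ `|y|); last by rewrite ler_peMl// ler1n.
  by rewrite ler_norml fle andbT lerNl -fN -(normrN y) fle.
Qed.

(** A type alias, so that restricting scalars to [R] does not put a second module structure on [E]
    itself. *)
Definition realification (R : realType) (E : lmodType R[i]) : Type := E.

Section Realification.
Context {R : realType} {E : lmodType R[i]}.

HB.instance Definition _ := GRing.Zmodule.copy (realification E) E.

Let scale (a : R) (x : realification E) : realification E := a%:C *: (x : E).

Let scaleA a b x : scale a (scale b x) = scale (a * b) x.
Proof. by rewrite /scale scalerA rmorphM. Qed.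

Let scale1 : left_id 1 scale.
Proof. by move=> x; rewrite /scale scale1r. Qed.

Let scaleDr : right_distributive scale +%R.
Proof. by move=> a x y; rewrite /scale scalerDr. Qed.

Let scaleDl x : {morph scale^~ x : a b / a + b}.
Proof. by move=> a b; rewrite /scale rmorphD scalerDl. Qed.

HB.instance Definition _ := GRing.Zmodule_isLmodule.Build R (realification E)
  scaleA scale1 scaleDr scaleDl.

End Realification.

Lemma realification_scaleE (R : realType) (E : lmodType R[i]) (a : R) (x : E) :
  a *: (x : realification E) = a%:C *: x.
Proof. by []. Qed.

Lemma normC_Re (R : realType) (E : normedModType R[i]) (x : E) :
  `|x| = (complex.Re `|x|)%:C.
Proof. by rewrite RRe_real// ger0_real. Qed.

(** A real functional [g] norming [x] is complexified to [h y = g y - i g (i y)]. Bounding the two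
    terms separately produces the factor 2. As [h x] has real part [g x], the norm of [x], its
    modulus is large enough to normalize by. *)
Lemma norming_functionals_complex (R : realType) (E : normedModType R[i]) :
  norming_functionals E.
Proof.
move=> x x0.
pose p (y : realification E) : R := complex.Re `|y : E|.
have pD y z : p (y + z) <= p y + p z.
  by rewrite -lecR rmorphD /= -!normC_Re; exact: ler_normD.
have pZ a y : p (a *: y) = `|a| * p y.
  apply: complexI; rewrite rmorphM /= -!normC_Re realification_scaleE normrZ.
  by congr (_ * _); rewrite normc_def /= expr0n addr0 sqrtr_sqr.
have [g [glin gle gx]] := hahn_banach pD pZ x.
have g0 : g 0 = 0 by have := glin 1 0 0; rewrite scale1r add0r mul1r; lra.
have gD y z : g ((y : E) + z) = g y + g z.
  by have := glin 1 y z; rewrite scale1r mul1r.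
have gZ a (y : E) : g (a%:C *: y) = a * g y.
  by have := glin a y 0; rewrite !addr0 g0 addr0.
have gN (y : E) : g (- y) = - g y.
  by have := gZ (-1) y; rewrite rmorphN1 scaleN1r mulN1r.
have g_norm (y : E) : `|(g y)%:C| <= `|y|.
  rewrite normc_def /= expr0n addr0 sqrtr_sqr normC_Re lecR.
  rewrite ler_norml gle andbT lerNl -gN.
  by apply: le_trans (gle _) _; rewrite /p normrN.
pose h (y : E) : R[i] := g y +i* (- g ('i *: y)).
have hlin : scalar h.
  move=> [a b] u v.
  rewrite /h (_ : a +i* b = a%:C + b%:C * 'i); last by simpc.
  rewrite !scalerDr !scalerDl !gD -!scalerA gZ gZ !scalerDr.
  rewrite gD (scalerA 'i a%:C) (mulrC 'i) -scalerA gZ.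
  rewrite (scalerA 'i b%:C) (mulrC 'i) -scalerA gZ scalerA -expr2 sqr_i.
  rewrite scaleN1r gN; simpc; congr (_ +i* _); ring.
have h_norm y : `|h y| <= 2 * `|y|.
  rewrite /h (_ : _ +i* _ = (g y)%:C - 'i * (g ('i *: y))%:C); last by simpc.
  apply: le_trans (ler_normB _ _) _; rewrite mulr2n mulrDl mul1r lerD//.
  rewrite normrM (_ : `|'i| = 1 :> R[i]); last first.
    by rewrite normc_def /= expr0n add0r expr1n sqrtr1.
  rewrite mul1r; apply: le_trans (g_norm _) _.
  by rewrite normrZ normc_def /= expr0n add0r expr1n sqrtr1 mul1r.
have h_ge : `|x| <= `|h x|.
  rewrite normC_Re -[complex.Re `|x|]gx; apply: le_trans (normc_ge_Re (h x)).
  by rewrite lecR ler_norm.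
have hx0 : h x != 0.
  by rewrite -normr_gt0; apply: lt_le_trans h_ge; rewrite normr_gt0.
exists (fun y => h y / h x); split.
- by move=> a u v; rewrite hlin mulrDl mulrA.
- by rewrite divff.
- move=> y; rewrite normrM normfV mulrAC ler_pdivrMr ?normr_gt0//.
  by rewrite ler_pM.
Qed.

Lemma scalar_bundle (K : numFieldType) (E : lmodType K) (f : E -> K) :
  scalar f -> exists g : {scalar E}, f = g.
Proof.
move=> flin.
by exists (HB.pack_for {scalar E} f (GRing.isLinear.Build K E K *%R f flin)).
Qed.

(** * Dual bases and projections with norm controlled by the dimension *)

Definition lin_indep (K : numFieldType) (V : lmodType K) k (b : 'I_k -> V) :
    Prop :=
  forall c : 'I_k -> K, \sum_(i < k) c i *: b i = 0 -> forall i, c i = 0.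

Fixpoint proj_bound (K : numFieldType) k : K :=
  if k is k'.+1 then 2 + 3 * proj_bound K k' else 0.

Lemma proj_bound_ge0 (K : numFieldType) k : 0 <= proj_bound K k.
Proof. by elim: k => //= k IH; rewrite addr_ge0// mulr_ge0. Qed.

(* Deflation: a functional [f] with [f (b 0) = 1] splits off the line of [b 0],
   and the induction hypothesis applies to the other vectors pushed into the
   kernel of [f]; hence the recursion C_(k+1) = 2 + 3 C_k for the norm of the
   projection onto the span. *)
Lemma bounded_dual_basis (K : numFieldType) (E : normedModType K) k
    (b : 'I_k -> E) : norming_functionals E -> lin_indep b ->
  exists c : 'I_k -> {scalar E},
    (forall i j, c i (b j) = (i == j)%:R) /\
    (forall y, `|\sum_(i < k) c i y *: b i| <= proj_bound K k * `|y|).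
Proof.
move=> functionals; elim: k b => [b _|k IH b b_indep].
  exists (fun _ => \0); split; first by case.
  by move=> y; rewrite big_ord0 normr0 mul0r.
have b0 : b ord0 != 0.
  apply/eqP => b0.
  have := b_indep (fun i => (i == ord0)%:R) _ ord0.
  rewrite eqxx big_ord_recl b0 scaler0 add0r big1 => [/(_ erefl)/eqP|i _].
    by rewrite oner_eq0.
  by rewrite scale0r.
have [f0 [/scalar_bundle [f ->] fb0 f_norm]] := functionals _ b0.
pose b' i := b (lift ord0 i) - f (b (lift ord0 i)) *: b ord0.
have b'_indep : lin_indep b'.
  move=> c c0 i.
  (* The coefficient of [b ord0] turns the relation among the [b'] into one among the [b]. *)
  pose d j := if unlift ord0 j is Some l then c l
              else - \sum_(l < k) c l * f (b (lift ord0 l)).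
  suff /(b_indep d)/(_ (lift ord0 i)) : \sum_(j < k.+1) d j *: b j = 0.
    by rewrite /d liftK.
  rewrite big_ord_recl /d unlift_none scaleNr scaler_suml addrC -sumrB -[RHS]c0.
  apply: eq_bigr => l _; rewrite liftK /b' scalerBr.
  by rewrite scalerA.
have [c' [c'b c'_norm]] := IH b' b'_indep.
pose q y := y - f y *: b ord0.
have qlin : linear q.
  move=> a u v; rewrite /q linearP scalerDl -scalerA scalerBr.
  by rewrite opprD addrACA.
(* The coordinate at [ord0] is [f] corrected so as to vanish on the other vectors of [b]. *)
pose d i y := if unlift ord0 i is Some l then c' l (q y)
              else f y - \sum_(l < k) c' l (q y) * f (b (lift ord0 l)).
have dlin i : scalar (d i).
  move=> a u v; rewrite /d; case: unliftP => [l _|_]; rewrite qlin linearP//.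
  have -> : \sum_(l < k) c' l (a *: q u + q v) * f (b (lift ord0 l)) =
      a * (\sum_(l < k) c' l (q u) * f (b (lift ord0 l))) +
      \sum_(l < k) c' l (q v) * f (b (lift ord0 l)).
    by rewrite mulr_sumr -big_split; apply: eq_bigr => l _; rewrite linearP /=; ring.
  rewrite /=; ring.
have [c cE] := choice (fun i => scalar_bundle (dlin i)).
have qb0 : q (b ord0) = 0 by rewrite /q fb0 scale1r subrr.
exists c; split.
- move=> i j; rewrite -cE /d.
  case: (unliftP ord0 j) => [m ->|->]; case: unliftP => [l ->|->].
  + by rewrite -/(b' m) c'b (inj_eq lift_inj).
  + rewrite (bigD1 m)//= c'b eqxx mul1r big1 => [|l lm].
      by rewrite addr0 subrr.
    by rewrite c'b (negPf lm) mul0r.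
  + by rewrite qb0 linear0.
  + by rewrite fb0 big1 ?subr0// => l _; rewrite qb0 linear0 mul0r.
- move=> y.
  have -> : \sum_i c i y *: b i =
      f y *: b ord0 + \sum_(i < k) c' i (q y) *: b' i.
    rewrite big_ord_recl -cE /d unlift_none scalerBl -addrA; congr (_ + _).
    rewrite scaler_suml addrC -sumrB; apply: eq_bigr => i _.
    by rewrite -cE /d liftK /b' scalerBr scalerA.
  have fy : `|f y *: b ord0| <= 2 * `|y| by rewrite normrZ.
  apply: le_trans (ler_normD _ _) _ => /=; rewrite mulrDl lerD//.
  (* The factor 3 is 1 + 2, a bound for the norm of [q]. *)
  apply: le_trans (c'_norm _) _; rewrite [3 * _]mulrC -mulrA.
  rewrite ler_wpM2l ?proj_bound_ge0//.
  apply: le_trans (ler_normB _ _) _.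
  by rewrite -[3]/(1 + 2) mulrDl mul1r lerD2l.
Qed.

(** * Surjectivity under finite-rank perturbation *)

(** Lifting the [u i] through [T] reduces the equation [S x = y] to a square linear system of size
    [k], whose matrix is invertible because [S] is injective. *)
Lemma finite_rank_perturbation_surj (K : fieldType) (E : lmodType K) k
    (T S : {linear E -> E}) (c : 'I_k -> {scalar E}) (u : 'I_k -> E) :
  (forall y, S y = T y + \sum_(i < k) c i y *: u i) ->
  (forall y, exists x, T x = y) -> injective S ->
  forall y, exists x, S x = y.
Proof.
move=> SE Tsurj Sinj y.
have [g gE] := choice (fun i => Tsurj (u i)).
pose M : 'M[K]_k := \matrix_(i, j) c j (g i).
pose comb (a : 'rV[K]_k) := \sum_(i < k) a 0 i *: g i.
have T_comb a : T (comb a) = \sum_(i < k) a 0 i *: u i.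
  by rewrite linear_sum; apply: eq_bigr => i _; rewrite linearZ /= gE.
have c_comb a j : c j (comb a) = (a *m M) 0 j.
  by rewrite linear_sum mxE; apply: eq_bigr => i _; rewrite linearZ /= mxE.
(* If [c z] is the row vector [a], the perturbation at [z] is [T (comb a)], so
   [S z = T (z + comb a)]; solving [z + comb a = w] amounts to
   [a *m (1 + M) = c w]. *)
have S_comb z (a : 'rV[K]_k) : (forall j, c j z = a 0 j) -> S z = T (z + comb a).
  move=> ca; rewrite SE linearD T_comb; congr (_ + _).
  by apply: eq_bigr => i _; rewrite ca.
(* A row [a] killed by [1%:M + M] puts [- comb a] in the kernel of [S]; hence this vector is 0, and
   so are its coordinates [a]. *)
have N_unit : 1%:M + M \in unitmx.
  rewrite -row_free_unit; apply: inj_row_free => a.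
  rewrite mulmxDr mulmx1 => /eqP; rewrite addr_eq0 => /eqP aM.
  have ca j : c j (- comb a) = a 0 j.
    by rewrite linearN /= c_comb [in RHS]aM [RHS]mxE.
  have /Sinj comb0 : S (- comb a) = S 0.
    by rewrite (S_comb _ _ ca) addNr !linear0.
  by apply/rowP => j; rewrite -ca comb0 linear0 mxE.
have [w <-] := Tsurj y.
pose v : 'rV[K]_k := \row_j c j w.
pose a := v *m invmx (1%:M + M).
have aE : a + a *m M = v by rewrite -{1}[a]mulmx1 -mulmxDr mulmxKV.
exists (w - comb a); rewrite (@S_comb _ a) ?subrK// => j.
rewrite linearB /= c_comb; have /rowP/(_ j) := aE.
by rewrite !mxE => <-; rewrite addrK.
Qed.

(** * Suprema and the operator norm *)

(** The form of completeness shared by [R] and the partially ordered [R[i]]; it applies to the sets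
    of norms that define [opnorm]. *)
Definition nonneg_sets_have_suprema (K : numFieldType) : Prop :=
  forall S : set K, (S !=set0)%classic -> (forall x, S x -> 0 <= x) ->
  (exists M, ubound S M) -> (supremums S !=set0)%classic.

Lemma nonneg_sets_have_suprema_real (R : realType) :
  nonneg_sets_have_suprema R.
Proof.
move=> S S0 _ SM; exists (sup S); split; first exact: ub_le_sup.
by move=> M MS; apply: ge_sup.
Qed.

(* An upper bound of a nonempty set of nonnegative elements of [R[i]] is real. *)
Lemma nonneg_sets_have_suprema_complex (R : realType) :
  nonneg_sets_have_suprema R[i].
Proof.
move=> S [s0 Ss0] Sge0 [M SM].
have S_real x : S x -> x = (complex.Re x)%:C.
  by move=> /Sge0 x0; rewrite RRe_real// ger0_real.
have ub_real N : ubound S N -> N = (complex.Re N)%:C.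
  move=> NS; rewrite RRe_real// ger0_real//.
  by apply: le_trans (NS _ Ss0); exact: Sge0.
pose S' := ((@complex.Re R) @` S)%classic.
have S'0 : (S' !=set0)%classic by exists (complex.Re s0), s0.
have ubP N : ubound S N -> ubound S' (complex.Re N).
  move=> NS _ [x Sx <-].
  by rewrite -lecR -(S_real _ Sx) -(ub_real _ NS); exact: NS.
exists (sup S')%:C; split.
- move=> x Sx; rewrite (S_real _ Sx) lecR; apply: ub_le_sup; last by exists x.
  by exists (complex.Re M); exact: ubP.
- by move=> N NS; rewrite (ub_real _ NS) lecR; apply: ge_sup => //; exact: ubP.
Qed.

(** The a priori bound [M] ensures that [opnorm A] is a true supremum, not the default 0; the
    estimate is then read off at the normalized vector. *)
Lemma le_opnorm (K : numFieldType) (X E : normedModType K)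
    (A : {linear X -> E}) (M : K) :
  nonneg_sets_have_suprema K -> (forall x, `|A x| <= M * `|x|) ->
  forall x, `|A x| <= opnorm A * `|x|.
Proof.
move=> suprema AM x; have [->|x0] := eqVneq x 0.
  by rewrite linear0 !normr0 mulr0.
have nx0 : 0 < `|x| by rewrite normr_gt0.
have M_ge0 : 0 <= M.
  by rewrite -(pmulr_lge0 _ nx0) (le_trans _ (AM x)).
rewrite -ler_pdivrMr//.
set S := [set `|A x| | x in [set x : X | `|x| <= 1]]%classic.
have S1 : S (`|A x| / `|x|).
  exists (`|x|^-1 *: x).
    by rewrite /= normrZ normfV normr_id mulVf ?gt_eqF.
  by rewrite linearZ normrZ normfV normr_id mulrC.
have [|||l lS] := suprema S; first by exists (`|A x| / `|x|).
- by move=> _ [y _ <-].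
- exists M => _ [y /= y1 <-]; apply: le_trans (AM y) _.
  by rewrite ler_piMr.
(* Both default branches are excluded: the empty set by [S1], a missing supremum by [lS]. *)
rewrite /opnorm -/S /supremum; case: ifPn => [/eqP S0|_].
  by move: S1; rewrite S0.
by case: xgetP => [m _ [+ _]|/(_ l)//]; exact.
Qed.

(** * Extending an embedding by perturbing an isometry *)

Lemma linear_bundle (K : numFieldType) (E F : lmodType K) (f : E -> F) :
  linear f -> exists g : {linear E -> F}, f = g.
Proof.
move=> flin.
by exists (HB.pack_for {linear E -> F} f (GRing.isLinear.Build K E F *:%R f flin)).
Qed.

(** The tolerance makes the perturbation at most [e / (1 + e)] in norm, and [1 - e / (1 + e)] is
    exactly [(1 + e)^-1], the lower constant of an [e]-isometry. Adding 1 to [proj_bound K k] keeps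
    the divisor positive when [k = 0]. *)
Lemma extend_by_perturbation (K : numFieldType) (E : normedModType K) k
    (X : submodClosed E) (e : K) (phi : {linear subsp X -> E})
    (T : {linear E -> E}) :
  norming_functionals E -> Age_ k X -> 0 < e -> Isom T ->
  (forall x : subsp X,
    `|T (val x) - phi x| <= e / (1 + e) / (1 + proj_bound K k) * `|x|) ->
  exists2 S : {linear E -> E}, Isom_ e S &
    forall x : subsp X, S (val x) = phi x.
Proof.
move=> functionals [b [b_indep b_span]] e0 [T_isom T_surj] T_phi.
have e1 : 0 < 1 + e by rewrite addr_gt0.
have C1 : 0 < 1 + proj_bound K k by rewrite ltr_wpDr// proj_bound_ge0.
have vb_indep : lin_indep (fun i => val (b i)).
  move=> c c0; apply: b_indep; apply: val_inj; rewrite linear_sum linear0 -[RHS]c0.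
  by apply: eq_bigr => i _; rewrite linearZ.
have [c [cb c_norm]] := bounded_dual_basis functionals vb_indep.
have val_comb (a : 'I_k -> K) :
    val (\sum_(i < k) a i *: b i) = \sum_(i < k) a i *: val (b i).
  by rewrite linear_sum; apply: eq_bigr => i _; rewrite linearZ.
pose P y : subsp X := \sum_(i < k) c i y *: b i.
have val_P y : val (P y) = \sum_(i < k) c i y *: val (b i) by exact: val_comb.
have P_id x : P (val x) = x.
  have [a ->] := b_span x; rewrite /P; apply: eq_bigr => i _; congr (_ *: _).
  rewrite val_comb linear_sum (bigD1 i)//= linearZ /= cb eqxx mulr1.
  rewrite big1 ?addr0// => j ji.
  by rewrite linearZ /= cb eq_sym (negPf ji) mulr0.
(* The perturbation is written through coordinates to match [finite_rank_perturbation_surj]. *)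
pose u i := phi (b i) - T (val (b i)).
have uE y : \sum_(i < k) c i y *: u i = phi (P y) - T (val (P y)).
  rewrite linear_sum val_P linear_sum -sumrB; apply: eq_bigr => i _.
  by rewrite scalerBr !linearZ.
have S_lin : linear (fun y => T y + \sum_(i < k) c i y *: u i).
  move=> a y z; rewrite linearP scalerDr addrACA; congr (_ + _).
  rewrite scaler_sumr -big_split; apply: eq_bigr => i _ /=.
  by rewrite linearP scalerDl scalerA.
have [S SE'] := linear_bundle S_lin.
have SE y : S y = T y + \sum_(i < k) c i y *: u i by rewrite -SE'.
have u_norm y : `|\sum_(i < k) c i y *: u i| <= e / (1 + e) * `|y|.
  rewrite uE distrC; apply: le_trans (T_phi _) _.
  rewrite mulrAC ler_pdivrMr// -!mulrA ler_pM2l//.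
  rewrite ler_pM2l ?invr_gt0//.
  rewrite (_ : `|P y| = `|val (P y)|)// val_P.
  apply: le_trans (c_norm y) _.
  by rewrite mulrC ler_wpM2l// ler_wpDl.
have S_emb : Emb e S.
  move=> y; rewrite SE; split.
  - apply: le_trans (lerB_normD _ _); rewrite T_isom lerBrDr.
    apply: le_trans (lerD (lexx _) (u_norm y)) _.
    by rewrite -mulrDl -[X in X + _]mul1r -mulrDl divff ?gt_eqF// mul1r.
  - apply: le_trans (ler_normD _ _) _; rewrite T_isom mulrDl mul1r lerD2l.
    apply: le_trans (u_norm y) _; rewrite ler_wpM2r// ler_pdivrMr//.
    by rewrite ler_peMr ?lerDl// ltW.
have S_inj : injective S.
  move=> y z Syz; apply/eqP; rewrite -subr_eq0 -normr_le0.
  have [+ _] := S_emb (y - z).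
  by rewrite linearB Syz subrr normr0 pmulr_rle0// invr_gt0.
exists S; last by move=> x; rewrite SE uE P_id addrC subrK.
split => // y _.
have T_surj' z : exists x, T x = z by have [x _ <-] := T_surj z I; exists x.
have [x <-] := finite_rank_perturbation_surj SE T_surj' S_inj y.
by exists x.
Qed.

(** * From the approximate to the exact extension property *)

Section Fraisse_almost_Fraisse.
Context {K : numFieldType} {E : completeNormedModType K}.
Hypothesis suprema : nonneg_sets_have_suprema K.
Hypothesis functionals : norming_functionals E.

(** The common core of both implications: with [X] and [d] fixed, the uniform and the weak property
    supply the same last hypothesis. *)
Let extend_embedding (k : nat) (X : submodClosed E) (e d : K)
    (phi : {linear subsp X -> E}) :
  Age_ k X -> 0 < e -> 0 < d -> Emb d phi ->
  (forall psi psi' : {linear subsp X -> E}, Emb d psi -> Emb d psi' ->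
     exists2 T : {linear E -> E}, Isom T &
       opnorm ((T \o psi) \- psi') < e / (1 + e) / (1 + proj_bound K k)) ->
  exists2 S : {linear E -> E}, Isom_ e S &
    forall x : subsp X, S (val x) = phi x.
Proof.
move=> Xk e0 d0 phi_emb close.
pose incl : {linear subsp X -> E} := \val.
have incl_emb : Emb d incl.
  move=> x; have d1 : 1 <= 1 + d by rewrite lerDl ltW.
  by split; [rewrite ler_piMl// invf_le1// (lt_le_trans _ d1)|rewrite ler_peMl].
have [T T_isom T_close] := close _ _ incl_emb phi_emb.
apply: (extend_by_perturbation functionals Xk e0 T_isom) => x.
(* The crude bound [1 + (1 + d)] adds those of [T \o incl] and [phi]; it only certifies
   boundedness. *)
have := @le_opnorm K _ _ ((T \o incl) \- phi) (1 + (1 + d)) suprema _ x.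
move=> /(_ _)/le_trans; apply => [y|]; last by rewrite ler_wpM2r// ltW.
apply: le_trans (ler_normB _ _) _; have [T_norm _] := T_isom.
have [_ phi_le] := phi_emb y.
by rewrite mulrDl mul1r lerD// /= T_norm.
Qed.

Let tolerance_gt0 (e : K) k : 0 < e -> 0 < e / (1 + e) / (1 + proj_bound K k).
Proof.
move=> e0; apply: divr_gt0; first by rewrite divr_gt0 ?addr_gt0.
by rewrite ltr_wpDr// proj_bound_ge0.
Qed.

Lemma fraisse_almost_fraisse : fraisse E -> almost_fraisse E.
Proof.
move=> EF k e e0.
have [d d0 dP] := EF _ k (tolerance_gt0 k e0); exists d => // X Xk phi phi_emb.
exact: (extend_embedding Xk e0 d0 phi_emb (dP X Xk)).
Qed.

Lemma weak_fraisse_weak_almost_fraisse :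
  weak_fraisse E -> weak_almost_fraisse E.
Proof.
move=> EF X e [k Xk] e0.
have [d d0 dP] := EF _ X (tolerance_gt0 k e0) (ex_intro _ k Xk).
exists d => // phi phi_emb.
exact: (extend_embedding Xk e0 d0 phi_emb dP).
Qed.

End Fraisse_almost_Fraisse.

Theorem proposition4p6 (R : realType) :
  (forall E : completeNormedModType R,
     (fraisse E -> almost_fraisse E) /\
     (weak_fraisse E -> weak_almost_fraisse E)) /\
  (forall E : completeNormedModType R[i],
     (fraisse E -> almost_fraisse E) /\
     (weak_fraisse E -> weak_almost_fraisse E)).
Proof.
have sR := @nonneg_sets_have_suprema_real R.
have sC := @nonneg_sets_have_suprema_complex R.
split=> E; split.
- exact: fraisse_almost_fraisse sR (@norming_functionals_real R E).
- exact: weak_fraisse_weak_almost_fraisse sR (@norming_functionals_real R E).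
- exact: fraisse_almost_fraisse sC (@norming_functionals_complex R E).
- exact: weak_fraisse_weak_almost_fraisse sC (@norming_functionals_complex R E).
Qed.
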